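(* Let $\mathbb{I}$ be a consistent interval which is a bounded distributive lattice satisfying the Phoa principle and equipped with an internal sum structure that factors binary meets. Then $\mathbb{I}$ is based Segal complete: for every $j:\mathbb{I}$, every function $\alpha\colon[\![j]\!]_\bot\to\mathbb{I}$ extends uniquely along the inclusion $[\![j]\!]_\bot\hookrightarrow\mathbb{I}/j$, i.e. the restriction map $\mathbb{I}^{\mathbb{I}/j}\to\mathbb{I}^{[\![j]\!]_\bot}$ is an equivalence.
   Context: Homotopy type theory. An interval is a set $\mathbb{I}$ with bounded meet-semilattice structure $(0,1,\sqcap)$, $i\sqsubseteq j$ meaning $i\sqcap j=i$; $[\![i]\!]:\equiv(i=1)$. Consistent: $0\neq1$. Bounded distributive lattice: $\mathbb{I}$ also has binary joins $\sqcup$ making it a bounded distributive lattice. Phoa principle: every $\alpha\colon\mathbb{I}\to\mathbb{I}$ is monotone, and $\alpha,\beta\colon\mathbb{I}\to\mathbb{I}$ agreeing at $0$ and $1$ are equal. $L(X):\equiv\sum_{i:\mathbb{I}}X^{[\![i]\!]}$. An internal sum structure is a function $\Sigma\colon L(\mathbb{I})\to\mathbb{I}$ such that the square with top $\{(1,\lambda\_.1)\}\to\{1\}$, left $\{(1,\lambda\_.1)\}\hookrightarrow L(\mathbb{I})$, right $\{1\}\hookrightarrow\mathbb{I}$ and bottom $\Sigma$ is a pullback; it factors binary meets if $\Sigma(i,\lambda\_.j)=i\sqcap j$. $\mathbb{I}/j:\equiv\{i\mid i\sqsubseteq j\}$. The join $P*X$ is the pushout of $P\leftarrow P\times X\to X$;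 the Sierpiński cone of $X$ is $X_\bot:\equiv\sum_{i:\mathbb{I}}(i=0)*X$; $[\![j]\!]_\bot$ is the Sierpiński cone of the proposition $[\![j]\!]$, $\simeq\{i:\mathbb{I}\mid i=0\lor j=1\}$, included in $\mathbb{I}/j$ by $i\mapsto i$. A type is based Segal complete if for every $j$ it is local (restriction along the map is an equivalence) for $[\![j]\!]_\bot\hookrightarrow\mathbb{I}/j$. *)

(* Defs.v *)
(* A shallow embedding of the set-level fragment of homotopy type theory.
   Identity types are Rocq's [=], which eliminates into [Type]; uniqueness of
   identity proofs is never presupposed, so sets carry it as data ([is_set]).

   The setting is intuitionistic: decidable equality, hence also excluded
   middle, refutes the Phoa principle for a consistent interval (send 0 to 1
   and everything else to 0).  This is why the intervals below are bare types
   rather than instances of MathComp's lattices, which are all [eqType]s. *)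

Set Implicit Arguments.
Unset Strict Implicit.
Unset Printing Implicit Defensive.

Definition is_set (A : Type) : Type := forall (x y : A) (p q : x = y), p = q.

Definition is_contr (A : Type) : Type := {c : A & forall x : A, c = x}.

Definition fiber (A B : Type) (f : A -> B) (b : B) : Type := {a : A & f a = b}.

Definition is_equiv (A B : Type) (f : A -> B) : Type :=
  forall b : B, is_contr (fiber f b).

Definition is_local (A B : Type) (f : A -> B) (X : Type) : Type :=
  is_equiv (fun (h : B -> X) (a : A) => h (f a)).

Definition singleton (A : Type) (a : A) : Type := {x : A & x = a}.

Definition pullback (B C D : Type) (b : B -> D) (r : C -> D) : Type :=
  {x : B & {y : C & b x = r y}}.

Definition pullback_gap (A B C D : Type) (t : A -> C) (l : A -> B)
    (r : C -> D) (b : B -> D) (comm : forall a, b (l a) = r (t a)) :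
    A -> pullback b r :=
  fun a => existT _ (l a) (existT _ (t a) (comm a)).

Definition is_pullback (A B C D : Type) (t : A -> C) (l : A -> B)
    (r : C -> D) (b : B -> D) (comm : forall a, b (l a) = r (t a)) : Type :=
  is_equiv (pullback_gap comm).

Definition cocone (A B C : Type) (f : A -> B) (g : A -> C) (Y : Type) : Type :=
  {u : B -> Y & {v : C -> Y & forall a, u (f a) = v (g a)}}.

Definition cocone_comp (A B C : Type) (f : A -> B) (g : A -> C) (D Y : Type)
    (k : cocone f g D) (h : D -> Y) : cocone f g Y :=
  existT _ (fun b => h (projT1 k b))
    (existT _ (fun c => h (projT1 (projT2 k) c))
       (fun a => f_equal h (projT2 (projT2 k) a))).

(* Rocq has no higher inductive types, so the pushout type former of homotopy
   type theory is passed around as an explicit structure, specified by its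
   universal property. *)
Record pushouts : Type := Pushouts {
  pushout : forall A B C : Type, (A -> B) -> (A -> C) -> Type;
  pushout_cocone : forall (A B C : Type) (f : A -> B) (g : A -> C),
    cocone f g (pushout f g);
  pushout_universal : forall (A B C : Type) (f : A -> B) (g : A -> C) (Y : Type),
    is_equiv (fun h : pushout f g -> Y => cocone_comp (pushout_cocone f g) h)
}.

Definition pushout_rec (po : pushouts) (A B C : Type) (f : A -> B) (g : A -> C)
    (Y : Type) (k : cocone f g Y) : pushout po f g -> Y :=
  projT1 (projT1 (pushout_universal po k)).

Definition join (po : pushouts) (P X : Type) : Type :=
  pushout po (@fst P X) (@snd P X).

Record interval : Type := Interval {
  carrier :> Type;
  carrier_set : is_set carrier;
  zero : carrier;
  one : carrier;
  meet : carrier -> carrier -> carrier;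
  meetA : forall i j k, meet i (meet j k) = meet (meet i j) k;
  meetC : forall i j, meet i j = meet j i;
  meetI : forall i, meet i i = i;
  meet0 : forall i, meet zero i = zero;
  meet1 : forall i, meet one i = i
}.

Arguments zero {_}.
Arguments one {_}.

Declare Scope interval_scope.
Open Scope interval_scope.

Notation "i ⊓ j" := (meet i j) (at level 40, left associativity) : interval_scope.

Definition le (I : interval) (i j : I) : Prop := i ⊓ j = i.

Notation "i ⊑ j" := (le i j) (at level 70, no associativity) : interval_scope.

Definition holds (I : interval) (i : I) : Prop := i = one.

Notation "⟦ i ⟧" := (holds i) (at level 0, i at level 99) : interval_scope.

Definition consistent (I : interval) : Prop := @zero I <> one.

Record is_bounded_distributive_lattice (I : interval) (vee : I -> I -> I) :
    Prop := BoundedDistributiveLattice {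
  veeA : forall i j k, vee i (vee j k) = vee (vee i j) k;
  veeC : forall i j, vee i j = vee j i;
  veeI : forall i, vee i i = i;
  vee0 : forall i, vee zero i = i;
  meet_absorbs_vee : forall i j, i ⊓ vee i j = i;
  vee_absorbs_meet : forall i j, vee i (i ⊓ j) = i;
  meet_vee_distr : forall i j k, i ⊓ vee j k = vee (i ⊓ j) (i ⊓ k)
}.

Definition monotone (I : interval) (alpha : I -> I) : Prop :=
  forall i j, i ⊑ j -> alpha i ⊑ alpha j.

Definition phoa_principle (I : interval) : Prop :=
  (forall alpha : I -> I, monotone alpha) /\
  (forall alpha beta : I -> I,
     alpha zero = beta zero -> alpha one = beta one -> alpha = beta).

Definition lift (I : interval) (X : Type) : Type := {i : I & ⟦i⟧ -> X}.

Definition lift_one (I : interval) : lift I I :=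
  existT (fun i : I => ⟦i⟧ -> I) one (fun _ => one).

Record internal_sum (I : interval) : Type := InternalSum {
  isum :> lift I I -> I;
  isum_one : forall x : singleton (lift_one I), isum (projT1 x) = one;
  isum_pullback :
    @is_pullback (singleton (lift_one I)) (lift I I) (singleton (@one I)) I
      (fun _ => existT _ one eq_refl)
      (fun x => projT1 x)
      (fun y => projT1 y)
      isum isum_one
}.

Definition factors_binary_meets (I : interval) (S : internal_sum I) : Prop :=
  forall i j : I, S (existT _ i (fun _ => j)) = i ⊓ j.

Definition slice (I : interval) (j : I) : Type := {i : I & i ⊑ j}.

Definition sierpinski_cone (po : pushouts) (I : interval) (X : Type) : Type :=
  {i : I & join po (i = zero) X}.

Lemma zero_le (I : interval) (i j : I) : i = zero -> i ⊑ j.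
Proof. intros ->; apply meet0. Qed.

Lemma le_holds (I : interval) (i j : I) : ⟦j⟧ -> i ⊑ j.
Proof. intros e; unfold le; rewrite e, meetC; apply meet1. Qed.

Definition cone_le (po : pushouts) (I : interval) (j i : I) :
    join po (i = zero) ⟦j⟧ -> i ⊑ j :=
  pushout_rec
    (existT _ (@zero_le I i j)
       (existT _ (@le_holds I i j) (fun _ => carrier_set _ _))).

Definition cone_inclusion (po : pushouts) (I : interval) (j : I) :
    sierpinski_cone po I ⟦j⟧ -> slice j :=
  fun x => existT _ (projT1 x) (cone_le (projT2 x)).

Definition based_segal_complete (po : pushouts) (I : interval) (X : Type) :
    Type :=
  forall j : I, is_local (@cone_inclusion po I j) X.

(* Main.v *)
(** In the presence of joins, the Phoa principle says that every
    [alpha : I -> I] is the affine map [i |-> alpha 0 ∨ (i ⊓ alpha 1)].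
    Precomposing with the retraction [i |-> i ⊓ j] of [I] onto [I/j], every
    [f : I/j -> I] has the form [f i = f 0 ∨ (i ⊓ f j)].
    - Uniqueness: since [i ⊑ j], the map [f] depends only on [f 0] and on
      [j ⊓ f j = Σ(j, λ_. f j)], hence only on [f 0] and on the restriction of
      [f j] to [⟦j⟧].
    - Existence: a map [k] on the cone has a value [a] at [0] and a partial
      value [b : ⟦j⟧ -> I] at [j]; the extension is [i |-> a ∨ (i ⊓ Σ(j, b))]. *)

From Stdlib Require Import FunctionalExtensionality.
Require Import Defs.

Set Implicit Arguments.
Unset Strict Implicit.
Unset Printing Implicit Defensive.

(** Hedberg's argument: [r] is recovered from [c x z r] by cancelling [c x x eq_refl], so constancy
    of [c] forces uniqueness. *)
Lemma is_set_of_constant_endomap (A : Type) (c : forall x y : A, x = y -> x = y) :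
  (forall (x y : A) (p q : x = y), c x y p = c x y q) -> is_set A.
Proof.
  intros Hc x y p q.
  assert (K : forall (z : A) (r : x = z),
             r = eq_trans (eq_sym (c x x eq_refl)) (c x z r)).
  { intros z r; destruct r; destruct (c x x eq_refl); reflexivity. }
  rewrite (K y p), (K y q), (Hc x y p q); reflexivity.
Qed.

Lemma is_set_fun (A B : Type) : is_set B -> is_set (A -> B).
Proof.
  intros HB.
  (* The round trip through pointwise equalities is constant, since those live in the set [B]. *)
  apply (is_set_of_constant_endomap
           (c := fun f g p => functional_extensionality f g (equal_f p))).
  intros f g p q; f_equal.
  apply functional_extensionality_dep; intros x; apply HB.
Qed.

Lemma slice_eq (I : interval) (j : I) (x y : slice j) :
  projT1 x = projT1 y -> x = y.
Proof.
  destruct x as [x hx], y as [y hy]; simpl; intros e; destruct e.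
  f_equal; apply carrier_set.
Qed.

Lemma cocone_eq (A B C : Type) (f : A -> B) (g : A -> C) (Y : Type)
    (k l : cocone f g Y) :
  is_set Y ->
  (forall b, projT1 k b = projT1 l b) ->
  (forall c, projT1 (projT2 k) c = projT1 (projT2 l) c) ->
  k = l.
Proof.
  destruct k as [u [v s]], l as [u' [v' s']]; simpl; intros HY Hu Hv.
  apply functional_extensionality in Hu, Hv; subst u' v'.
  do 2 f_equal; apply functional_extensionality_dep; intros a; apply HY.
Qed.

(** Both maps lie in the contractible fiber over the cocone of [v]. *)
Lemma pushout_fun_eq (po : pushouts) (A B C : Type) (f : A -> B) (g : A -> C)
    (Y : Type) (u v : pushout po f g -> Y) :
  is_set Y ->
  (forall b, u (projT1 (pushout_cocone po f g) b) =
             v (projT1 (pushout_cocone po f g) b)) ->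
  (forall c, u (projT1 (projT2 (pushout_cocone po f g)) c) =
             v (projT1 (projT2 (pushout_cocone po f g)) c)) ->
  u = v.
Proof.
  intros HY Hl Hr.
  assert (E : cocone_comp (pushout_cocone po f g) u =
              cocone_comp (pushout_cocone po f g) v).
  { apply cocone_eq; simpl; assumption. }
  destruct (pushout_universal po
              (cocone_comp (pushout_cocone po f g) v)) as [c Hc].
  pose proof (f_equal (@projT1 _ _) (Hc (existT _ u E))) as Hu.
  pose proof (f_equal (@projT1 _ _) (Hc (existT _ v eq_refl))) as Hv.
  exact (eq_trans (eq_sym Hu) Hv).
Qed.

Section Lattice.

Variables (I : interval) (vee : I -> I -> I).
Hypothesis lat : is_bounded_distributive_lattice vee.
Hypothesis phoa : phoa_principle I.

Lemma vee0_meet0 (a b : I) : vee a (zero ⊓ b) = a.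
Proof. rewrite meet0, (veeC lat); apply (vee0 lat). Qed.

Lemma phoa_affine (alpha : I -> I) (i : I) :
  alpha i = vee (alpha zero) (i ⊓ alpha one).
Proof.
  destruct phoa as [mono ext]; revert i; apply equal_f, ext.
  - symmetry; apply vee0_meet0.
  (* At 1, monotonicity gives [alpha zero ⊑ alpha one], so the join absorbs the first term. *)
  - rewrite meet1, <- (mono alpha zero one (meet0 _)), meetC, (veeC lat).
    symmetry; apply (vee_absorbs_meet lat).
Qed.

Lemma slice_affine (j : I) (f : slice j -> I) (o t x : slice j) :
  projT1 o = zero -> projT1 t = j ->
  f x = vee (f o) (projT1 x ⊓ f t).
Proof.
  intros ho ht.
  assert (r : forall i : I, i ⊓ j ⊑ j)
    by (intros i; unfold le; rewrite <- meetA, meetI; reflexivity).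
  pose proof (phoa_affine (fun i => f (existT _ (i ⊓ j) (r i))) (projT1 x)) as E.
  cbv beta in E.
  rewrite (slice_eq (x := existT _ (projT1 x ⊓ j) _) (y := x) (projT2 x)) in E.
  rewrite (slice_eq (x := existT _ (zero ⊓ j) _) (y := o)) in E
    by (simpl; rewrite ho; apply meet0).
  rewrite (slice_eq (x := existT _ (one ⊓ j) _) (y := t)) in E
    by (simpl; rewrite ht; apply meet1).
  exact E.
Qed.

End Lattice.

(** Given [p], the family [b] is constant because [⟦j⟧] is a proposition, and [j] is 1. *)
Lemma isum_holds (I : interval) (S : internal_sum I) (j : I) (b : ⟦j⟧ -> I)
    (p : ⟦j⟧) :
  factors_binary_meets S -> S (existT _ j b) = b p.
Proof.
  intros fac.
  transitivity (S (existT _ j (fun _ => b p))).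
  - do 2 f_equal; apply functional_extensionality; intros q.
    f_equal; apply carrier_set.
  - rewrite fac; exact (eq_trans (f_equal (fun i => i ⊓ b p) p) (meet1 _)).
Qed.

(** As the sum of a constant family over [⟦j⟧], the meet [j ⊓ a] sees [a] only where [j] holds. *)
Lemma meet_congr_holds (I : interval) (S : internal_sum I) (j a b : I) :
  factors_binary_meets S -> (⟦j⟧ -> a = b) -> j ⊓ a = j ⊓ b.
Proof.
  intros fac e; rewrite <- !fac; do 2 f_equal.
  apply functional_extensionality; exact e.
Qed.

Section Cone.

Variables (po : pushouts) (I : interval) (j : I).

Definition cone_zero (i : I) (e : i = zero) : sierpinski_cone po I ⟦j⟧ :=
  existT (fun i : I => join po (i = zero) ⟦j⟧) i
    (projT1 (pushout_cocone po fst snd) e).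

(** Under [p] all of [I] maps into the cone, so the Phoa principle applies to functions on the cone
    along this map. *)
Definition cone_holds (p : ⟦j⟧) (i : I) : sierpinski_cone po I ⟦j⟧ :=
  existT (fun i : I => join po (i = zero) ⟦j⟧) i
    (projT1 (projT2 (pushout_cocone po fst snd)) p).

Lemma cone_glue (p : ⟦j⟧) (i : I) (e : i = zero) :
  cone_zero e = cone_holds p i.
Proof.
  unfold cone_zero, cone_holds; f_equal.
  exact (projT2 (projT2 (pushout_cocone po fst snd)) (e, p)).
Qed.

Lemma cone_fun_eq (Y : Type) (u v : sierpinski_cone po I ⟦j⟧ -> Y) :
  is_set Y ->
  u (cone_zero eq_refl) = v (cone_zero eq_refl) ->
  (forall p i, u (cone_holds p i) = v (cone_holds p i)) ->
  u = v.
Proof.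
  intros HY Hz Hh; apply functional_extensionality; intros [i w].
  revert w; apply equal_f, pushout_fun_eq; [exact HY | | intros p; apply Hh].
  intros e; change (u (cone_zero e) = v (cone_zero e)).
  subst i; exact Hz.
Qed.

End Cone.

Theorem theoremV6 (po : pushouts) (I : interval) (vee : I -> I -> I)
    (S : internal_sum I) :
  consistent I ->
  is_bounded_distributive_lattice vee ->
  phoa_principle I ->
  factors_binary_meets S ->
  based_segal_complete po I I.
Proof.
  intros _ lat phoa fac j k.
  pose (a := k (cone_zero po j eq_refl)).
  pose (b := fun p : ⟦j⟧ => k (cone_holds po p j)).
  pose (h := fun x : slice j => vee a (projT1 x ⊓ S (existT _ j b))).
  assert (hk : (fun x => h (cone_inclusion x)) = k).
  { apply cone_fun_eq.
    - apply carrier_set.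
    - apply (vee0_meet0 lat).
    (* Here the sum is [b p]; the glue moves [a] onto [cone_holds p] at 0, and [j] becomes 1,
       leaving an instance of [phoa_affine]. *)
    - intros p i; unfold h; simpl.
      rewrite (isum_holds b p fac); unfold a, b.
      rewrite (cone_glue po p).
      replace (cone_holds po p j) with (cone_holds po p one)
        by (f_equal; symmetry; exact p).
      symmetry; apply (phoa_affine lat phoa (fun i => k (cone_holds po p i))). }
  exists (existT _ h hk); intros [h' hk'].
  assert (E : h = h').
  { apply functional_extensionality; intros x.
    pose (o := cone_inclusion (cone_zero po j eq_refl)).
    pose (t := existT _ j (meetI j) : slice j).
    assert (agree : forall y, h (cone_inclusion y) = h' (cone_inclusion y))
      by (intros y; apply (equal_f (eq_trans hk (eq_sym hk')))).
    (* Where [j] holds, [t] is the image of a cone point. *)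
    assert (at_j : j ⊓ h t = j ⊓ h' t).
    { apply (meet_congr_holds fac); intros p.
      rewrite (slice_eq (x := t) (y := cone_inclusion (cone_holds po p j)) eq_refl).
      apply agree. }
    rewrite (slice_affine lat phoa h (o := o) (t := t) x eq_refl eq_refl).
    rewrite (slice_affine lat phoa h' (o := o) (t := t) x eq_refl eq_refl).
    (* Writing [projT1 x] as [projT1 x ⊓ j] exposes the meets with [j] compared in [at_j]. *)
    rewrite <- (projT2 x), <- !meetA, at_j.
    unfold o; rewrite agree; reflexivity. }
  clearbody h; subst h'; f_equal.
  apply (is_set_fun (@carrier_set I)).
Qed.
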